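(* Fix a finite set $B$ and an element $q_0\notin B$, and put $\hat B=B\cup\{q_0\}$. Let $\mathcal{C}_B$ be the class of all triples $(X,E,p)$ where $(X,E)$ is a finite connected graph with $B\subset X$ and $q_0\notin X$, $(X,E)$ satisfies the Two-Points Condition with respect to $B$, and $p=(p_{xy})_{x,y\in X}$ is the transition matrix of an admissible random walk on $(X,E)$. Two triples $(X,E,p)$ and $(X',E',p')$ in $\mathcal{C}_B$ are called equivalent if there is a graph isomorphism $\Phi:(X,E)\to(X',E')$ with $\Phi(b)=b$ for all $b\in B$ and $p'_{\Phi(x)\Phi(y)}=p_{xy}$ for all $x,y\in X$. Then a single realization of the observed process $\hat H_t^{x_0}$, $t\in\mathbb{N}$, determines with probability one the graph (up to an isometry) and the transition matrix, even though the starting position $x_0\in X$ is unknown. Precisely: there is a map $R$ from $\hat B^{\mathbb{N}}$ to the equivalence classes of $\mathcal{C}_B$ such that for every $(X,E,p)\in\mathcal{C}_B$ and every $x_0\in X$, with probability one, $R\big((\hat H_t^{x_0})_{t\in\mathbb{N}}\big)$ is the equivalence class of $(X,E,p)$.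
   Context: Graphs are finite, undirected and simple; $x\sim y$ means $\{x,y\}\in E$; $\mathbb{N}=\{0,1,2,\dots\}$. Admissible random walk on $(X,E)$: for $x_0\in X$, $H_t^{x_0}$, $t\in\mathbb{N}$, is a homogeneous discrete-time Markov chain with state space $X$, $H_0^{x_0}=x_0$, and transition probabilities $p_{xy}=\mathbb{P}(H_{t+1}^{x_0}=y\mid H_t^{x_0}=x)$ satisfying: (1) $p_{xy}=0$ unless $x\sim y$ or $x=y$; (2) for $x\sim y$ or $x=y$, $p_{xy}=c_{xy}/m(x)$ with $m(x)=\sum_{z\sim x\text{ or }z=x}c_{xz}$ (so $m(x)>0$), for some numbers $c_{xy}=c_{yx}>0$ for all $x\sim y$, and $c_{xx}\ge 0$ for all $x\in X$ ($c_{xx}$ may be zero). Observed process: $\hat H_t^{x_0}=H_t^{x_0}$ if $H_t^{x_0}\in B$, and $\hat H_t^{x_0}=q_0$ if $H_t^{x_0}\in X\setminus B$. The graph distance between two vertices is the minimal number of edges of a path joining them. Given $S\subset X$, a point $x_0\in S$ is an extreme point of $S$ with respect to $B$ if there exists $b\in B$ (possibly $b=x_0$) such that $x_0$ is the unique nearest point in $S$ from $b$ with respect to the graph distance. $(X,E)$ satisfies the Two-Points Condition with respect to $B$ if every subset $S\subset X$ with cardinality at least $2$ has at least two extreme points with respect to $B$. ''With probability one'' means that the event contains an event of probability one. *)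

(* Defs.v *)
From HB Require Import structures.
From mathcomp Require Import all_boot all_order all_algebra.
From mathcomp Require Import all_classical all_reals all_analysis.
Set Implicit Arguments.
Unset Strict Implicit.
Unset Printing Implicit Defensive.
Import Order.TTheory GRing.Theory Num.Theory.
Local Open Scope classical_set_scope.
Local Open Scope ring_scope.

(* A graph is an edge relation e on a finite type X; B is a finite type with an
   injection bd : B -> X.  The set B together with the extra element q0 is
   option B, with q0 = None; in particular q0 lies neither in B nor in X. *)

Definition joined (X : finType) (e : rel X) (n : nat) (x y : X) : bool :=
  [exists q : n.-tuple X, path e x q && (last x q == y)].

(* In a connected graph the minimal number of edges is less than #|X|, so that
   the bounded search succeeds; see gdistP. *)
Definition gdist (X : finType) (e : rel X) (x y : X) : nat :=
  find (fun n => joined e n x y) (iota 0 #|X|).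

Lemma joinedP (X : finType) (e : rel X) (n : nat) (x y : X) :
  reflect (exists q : seq X, [/\ path e x q, last x q = y & size q = n])
          (joined e n x y).
Proof.
apply: (iffP existsP) => [[q /andP[eq /eqP lq]]|[q [eq lq /eqP sq]]].
  by exists q; rewrite size_tuple.
by exists (Tuple sq); rewrite /= eq lq eqxx.
Qed.

Lemma gdistP (X : finType) (e : rel X) (x y : X) : connect e x y ->
  (exists q, [/\ path e x q, last x q = y & size q = gdist e x y]) /\
  (forall q, path e x q -> last x q = y -> (gdist e x y <= size q)%N).
Proof.
move=> /connectP[q0 eq0 lq0].
have [q [eq uq lq]] : exists q, [/\ path e x q, uniq (x :: q) & last x q = y].
  by case: (shortenP eq0) lq0 => q eq uq _ lq; exists q.
have szq : (size q < #|X|)%N by rewrite -[(size q).+1]/(size (x :: q)) -(card_uniqP uq) max_card.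
have jq : joined e (size q) x y by apply/joinedP; exists q.
have hs : has (fun n => joined e n x y) (iota 0 #|X|).
  by apply/hasP; exists (size q) => //; rewrite mem_iota.
have lt_d : (gdist e x y < #|X|)%N by rewrite -[X in (_ < X)%N](size_iota 0) -has_find.
split.
  by apply/joinedP; have := nth_find 0%N hs; rewrite nth_iota.
move=> r er lr; rewrite leqNgt; apply/negP => lt_r.
have := before_find 0%N lt_r; rewrite nth_iota ?add0n ?(ltn_trans lt_r)//.
by move/negbT/negP; apply; apply/joinedP; exists r.
Qed.

Definition extreme (B X : finType) (bd : B -> X) (e : rel X)
    (S : {set X}) (x0 : X) : Prop :=
  x0 \in S /\
  exists b : B, forall x : X, x \in S -> x != x0 ->
    (gdist e (bd b) x0 < gdist e (bd b) x)%N.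

Definition two_points (B X : finType) (bd : B -> X) (e : rel X) : Prop :=
  forall S : {set X}, (2 <= #|S|)%N ->
    exists x y : X, [/\ x != y, extreme bd e S x & extreme bd e S y].

Definition admissible (R : realType) (X : finType) (e : rel X)
    (p : X -> X -> R) : Prop :=
  exists c : X -> X -> R,
    let m x := \sum_(z | e x z || (z == x)) c x z in
    [/\ forall x y, e x y -> c x y = c y x /\ 0 < c x y,
        forall x, 0 <= c x x,
        forall x, 0 < m x,
        forall x y, ~~ (e x y || (y == x)) -> p x y = 0 &
        forall x y, e x y || (y == x) -> p x y = c x y / m x].

Record netwalk (R : realType) (B : finType) : Type := NetWalk {
  vert : finType;
  bdry : B -> vert;
  edge : rel vert;
  trans : vert -> vert -> R;
  bdry_inj : injective bdry;
  edge_sym : symmetric edge;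
  edge_irr : irreflexive edge;
  vert_nonempty : (0 < #|vert|)%N;
  edge_connected : forall x y, connect edge x y;
  edge_two_points : two_points bdry edge;
  trans_admissible : admissible edge trans }.

Definition equivalent (R : realType) (B : finType) (G G' : netwalk R B) : Prop :=
  exists Phi : vert G -> vert G',
    [/\ bijective Phi,
        forall x y, edge (Phi x) (Phi y) = edge x y,
        forall b, Phi (bdry G b) = bdry G' b &
        forall x y, trans (Phi x) (Phi y) = trans x y].

(* Plain predicates rather than sets: netwalk R B quantifies over all finite
   types and lives in a larger universe than the argument of set. *)
Definition class_of (R : realType) (B : finType) (G : netwalk R B) :
  netwalk R B -> Prop := fun G' => equivalent G G'.

Definition netclass (R : realType) (B : finType) : Type :=
  {C : netwalk R B -> Prop | exists G, C = class_of G}.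

Definition netclass_of (R : realType) (B : finType) (G : netwalk R B) :
  netclass R B := exist _ (class_of G) (ex_intro _ G erefl).

(* Only meaningful when P C > 0. *)
Definition cprob (R : realType) (d : measure_display) (Omega : measurableType d)
    (P : probability Omega R) (A C : set Omega) : R :=
  fine (P (A `&` C)) / fine (P C).

Record markov_chain (R : realType) (d : measure_display)
    (Omega : measurableType d) (P : probability Omega R) (X : finType)
    (p : X -> X -> R) (x0 : X) (H : nat -> Omega -> X) : Prop := MarkovChain {
  chain_measurable : forall t x, measurable [set w | H t w = x];
  chain_init : P [set w | H 0%N w = x0] = 1%E;
  chain_markov : forall (t : nat) (h : nat -> X) (y : X),
    let past := [set w | forall s, (s <= t)%N -> H s w = h s] in
    (0 < P past)%E ->
    cprob P [set w | H t.+1 w = y] past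
    = cprob P [set w | H t.+1 w = y] [set w | H t w = h t];
  chain_trans : forall (t : nat) (x y : X),
    (0 < P [set w | H t w = x])%E ->
    cprob P [set w | H t.+1 w = y] [set w | H t w = x] = p x y }.

Definition observe (B X : finType) (bd : B -> X) (x : X) : option B :=
  [pick b | bd b == x].

(* The event E need not itself be measurable. *)
Definition with_probability_one (R : realType) (d : measure_display)
    (Omega : measurableType d) (P : probability Omega R) (E : set Omega) : Prop :=
  exists A : set Omega, [/\ measurable A, P A = 1%E & A `<=` E].

(* Main.v *)
Require Import Defs.
From mathcomp Require Import all_boot all_order all_algebra.
From mathcomp Require Import all_classical all_reals all_analysis.
From mathcomp Require Import zify ring lra.
Set Implicit Arguments.
Unset Strict Implicit.
Unset Printing Implicit Defensive.
Import Order.TTheory GRing.Theory Num.Theory.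
Local Open Scope classical_set_scope.
Local Open Scope ring_scope.

(** Why one observed path determines the network.

The argument has two halves.  They meet in the numbers
[kstep p n (bdry G b) (bdry G c)], the n-step transition probabilities between
observed vertices: the path reveals them almost surely, and they determine the
network.

From the path to these numbers.  For vertices x, y let D_t be the indicator of
H_t = x times the difference between the indicator of H_(t+n) = y and the
n-step probability of going from x to y.  By the Markov property D_s and D_t
are uncorrelated when their times differ by at least n, so the second moment of
D_0 + ... + D_(T-1) is at most 2nT.  Chebyshev's inequality and the
Borel-Cantelli lemma, along times T that grow exponentially, show that almost
surely this sum is o(T) ([ae_balanced]).  On such a path every vertex is visited
a positive proportion of the time ([balanced_recurrent]): the number of visits
to y is, up to o(T), the sum over x of the number of visits to x times the
n-step probability from x to y, and for each x one of these probabilities with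
n at most the number of vertices is positive.  Hence counting the visits to an
observed vertex b, and those followed n steps later by a visit to c, recovers
the n-step probability from b to c ([compatible_same_kernel]).

From these numbers to the network.  Write P for the transition operator and
delta_x for the indicator of x.  Functions f on X and f' on X' have the same
data when (P^n f)(b) = (P'^n f')(b) for all n and all observed b.  If the
n-step probabilities between observed vertices agree, then P^n delta_b and
P'^n delta_b have the same data.  Let x be the unique point of S nearest to b,
at distance k.  Then P^k delta_b restricted to S is a positive multiple of
delta_x.  Removing extreme points one after another therefore shows that data
determine a function ([observable]) and that every function on X has a partner
on X' ([same_data_total]); having the same data is the graph of a linear
bijection U.

The core is that U maps each delta_x to a multiple of some delta_u
([same_data_delta]).  Since a set with two points or more has an extreme point
other than x, the only functions with (P^k f)(b) = 0 whenever k < d(b, x) are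
the multiples of delta_x ([early_silence_supp]).  If U delta_x is nonnegative
and u is in its support, then no cancellation can occur, so delta_u satisfies
the same equations as U delta_x; its preimage is then a multiple of delta_x, and
U delta_x is a multiple of delta_u ([same_data_nonneg_delta]).  Nonnegativity
comes from the peeling again: if x is extreme in S for b, then
P'^k delta_b = U (P^k delta_b) is nonnegative and equals a positive multiple of
U delta_x outside the points already matched, where U delta_x vanishes.

Finally U maps the constant 1 to the constant 1, which makes the multiples equal
to 1, and it intertwines P with P'; so the bijection x -> u preserves the
transition matrix, hence the edges, which are its positive off-diagonal
entries. *)

(** * Multi-step transition probabilities *)

Fixpoint kstep (R : pzRingType) (X : finType) (p : X -> X -> R) (n : nat) (x y : X) : R :=
  if n is n'.+1 then \sum_z p x z * kstep p n' z y else (x == y)%:R.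

Section Kstep.
Context (R : numDomainType) (X : finType) (p : X -> X -> R).

Lemma kstepD m n x y :
  kstep p (m + n) x y = \sum_z kstep p m x z * kstep p n z y.
Proof.
elim: m x => [|m IH] x /=.
  rewrite (bigD1 x)//= eqxx mul1r big1 ?addr0// => z /negPf.
  by rewrite eq_sym => ->; rewrite mul0r.
under eq_bigr do rewrite IH mulr_sumr.
rewrite exchange_big; apply: eq_bigr => z _; rewrite mulr_suml.
by apply: eq_bigr => w _; rewrite mulrA.
Qed.

Lemma kstep1 x y : kstep p 1 x y = p x y.
Proof.
rewrite /= (bigD1 y)//= eqxx mulr1 big1 ?addr0// => z /negPf ->.
by rewrite mulr0.
Qed.

Lemma kstepS_last n x y : kstep p n.+1 x y = \sum_z kstep p n x z * p z y.
Proof.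
by rewrite -addn1 kstepD; apply: eq_bigr => z _; rewrite kstep1.
Qed.

Hypothesis p_ge0 : forall x y, 0 <= p x y.
Hypothesis p_sum1 : forall x, \sum_y p x y = 1.

Lemma kstep_ge0 n x y : 0 <= kstep p n x y.
Proof.
elim: n x => [|n IH] x /=; first by rewrite ler0n.
by apply: sumr_ge0 => z _; rewrite mulr_ge0.
Qed.

Lemma kstep_sum1 n x : \sum_y kstep p n x y = 1.
Proof.
elim: n x => [|n IH] x /=.
  by rewrite (bigD1 x)//= eqxx big1 ?addr0// => z /negPf; rewrite eq_sym => ->.
rewrite exchange_big /=.
by under eq_bigr do rewrite -mulr_sumr IH mulr1.
Qed.

Lemma kstep_le1 n x y : kstep p n x y <= 1.
Proof.
rewrite -(kstep_sum1 n x) (bigD1 y)//= lerDl.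
by apply: sumr_ge0 => z _; exact: kstep_ge0.
Qed.

End Kstep.

Lemma sum_delta (R : pzRingType) (X : finType) (f : X -> R) x :
  \sum_y f y * (x == y)%:R = f x.
Proof.
rewrite (bigD1 x)//= eqxx mulr1 big1 ?addr0// => y /negPf.
by rewrite eq_sym => ->; rewrite mulr0.
Qed.

(** * Supports of multi-step transitions and extreme points *)

Section Network.
Context (R : realType) (B : finType) (G : netwalk R B).
Local Notation X := (vert G).
Local Notation bd := (@bdry R B G).
Local Notation e := (@edge R B G).
Local Notation p := (@trans R B G).
Local Notation gd := (gdist e).
Local Notation pn := (kstep p).

(** The weights c are symmetric, so their row sums m form a reversing measure. *)
Lemma trans_reversible :
  exists m : X -> R, (forall x, 0 < m x) /\ forall x y, m x * p x y = m y * p y x.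
Proof.
have [c [/= csym cxx mgt0 pfar pnear]] := trans_admissible G.
exists (fun x => \sum_(z | e x z || (z == x)) c x z); split=> // x y.
have [exy|nexy] := boolP (e x y || (y == x)); last first.
  by rewrite (pfar x y)// (pfar y x) ?mulr0// edge_sym eq_sym.
have eyx : e y x || (x == y) by rewrite edge_sym eq_sym.
rewrite (pnear _ _ exy) (pnear _ _ eyx) mulrC divfK ?gt_eqF// mulrC divfK ?gt_eqF//.
by have [->//|nxy] := eqVneq x y; case/orP: exy => [/csym[]//|/eqP yx]; rewrite yx eqxx in nxy.
Qed.

Lemma trans_ge0 x y : 0 <= p x y.
Proof.
have [c [/= csym cxx mgt0 pfar pnear]] := trans_admissible G.
have [exy|/pfar ->//] := boolP (e x y || (y == x)).
rewrite pnear// divr_ge0 ?(ltW (mgt0 _))//.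
by case/orP: exy => [/csym[_ /ltW]//|/eqP ->].
Qed.

Lemma trans_edge_gt0 x y : e x y -> 0 < p x y.
Proof.
have [c [/= csym cxx mgt0 pfar pnear]] := trans_admissible G.
by move=> exy; rewrite pnear ?exy// divr_gt0//; case: (csym _ _ exy).
Qed.

Lemma trans_neq0 x y : p x y != 0 -> e x y || (y == x).
Proof.
have [c [/= _ _ _ pfar _]] := trans_admissible G.
by apply: contraNT => /pfar ->.
Qed.

Lemma trans_sum1 x : \sum_y p x y = 1.
Proof.
have [c [/= csym cxx mgt0 pfar pnear]] := trans_admissible G.
rewrite (bigID (fun y => e x y || (y == x)))/= [X in _ + X]big1 ?addr0; last by move=> y /pfar.
under eq_bigr => y exy do rewrite pnear//.
by rewrite -mulr_suml divff ?gt_eqF.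
Qed.

Local Notation pn_ge0 := (kstep_ge0 trans_ge0).

Lemma edge_trans x y : e x y = (x != y) && (0 < p x y).
Proof.
apply/idP/andP => [exy|[nxy pxy]].
  split; last exact: trans_edge_gt0.
  by apply/eqP => xy; move: exy; rewrite xy edge_irr.
have := trans_neq0 (lt0r_neq0 pxy).
by rewrite [y == x]eq_sym (negPf nxy) orbF.
Qed.

Lemma gdist_step x y z : e x z || (z == x) -> (gd x y <= (gd z y).+1)%N.
Proof.
have [_ minxy] := gdistP (edge_connected x y).
have [[q [eq lq sq]] _] := gdistP (edge_connected z y).
rewrite -sq => /orP[exz|/eqP zx].
  by apply: (minxy (z :: q)) => //=; rewrite exz.
by rewrite (leq_trans (minxy q _ _))// -?zx.
Qed.

Lemma kstep_eq0 n x y : (n < gd x y)%N -> pn n x y = 0.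
Proof.
elim: n x => [|n IH] x /= ltn.
  have [xy|//] := eqVneq x y.
  have [_ /(_ [::] isT)] := gdistP (edge_connected x y).
  by move=> /(_ xy); rewrite leqNgt ltn.
apply: big1 => z _; have [/eqP->|pxz] := boolP (p x z == 0); first by rewrite mul0r.
rewrite IH ?mulr0//; have := gdist_step y (trans_neq0 pxz); lia.
Qed.

Lemma kstep_path_gt0 x q : path e x q -> 0 < pn (size q) x (last x q).
Proof.
elim: q x => [|z q IH] x /=; first by rewrite eqxx.
case/andP=> exz /IH zq; rewrite (bigD1 z)//= ltr_pwDl//.
  by rewrite mulr_gt0// trans_edge_gt0.
by apply: sumr_ge0 => w _; rewrite mulr_ge0 ?trans_ge0 ?pn_ge0.
Qed.

Lemma kstep_gdist_gt0 x y : 0 < pn (gd x y) x y.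
Proof.
have [[q [eq lq <-]] _] := gdistP (edge_connected x y).
by rewrite -lq kstep_path_gt0.
Qed.

(** Reversibility multiplies the two quantities by positive weights; it transfers
every statement about the support of the rows of P^n to its columns. *)
Lemma kstep_eq0C n x y : pn n x y = 0 -> pn n y x = 0.
Proof.
have [m [m_gt0 mC]] := trans_reversible.
suff -> : pn n x y = m y / m x * pn n y x.
  move/eqP; rewrite mulf_eq0 mulf_eq0 invr_eq0.
  by rewrite [m y == 0]gt_eqF// [m x == 0]gt_eqF// => /eqP.
apply: (mulfI (lt0r_neq0 (m_gt0 x))).
rewrite mulrA mulrCA divff ?lt0r_neq0 ?mulr1//.
elim: n x y => [|n IH] x y; first by rewrite /= eq_sym; case: eqP => [->|]; rewrite ?mulr0.
rewrite kstepS_last /= !mulr_sumr.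
by apply: eq_bigr => z _; rewrite mulrA IH mulrAC -mC; ring.
Qed.

Lemma kstep_to_eq0 n x y : (n < gd y x)%N -> pn n x y = 0.
Proof. by move=> /kstep_eq0/kstep_eq0C. Qed.

Lemma kstep_to_gt0 x y : 0 < pn (gd y x) x y.
Proof.
rewrite lt_neqAle eq_sym pn_ge0 andbT; apply/eqP => /kstep_eq0C/eqP.
by rewrite gt_eqF// kstep_gdist_gt0.
Qed.

(** The function P^n f. *)
Definition stepf (n : nat) (f : X -> R) (x : X) : R := \sum_y pn n x y * f y.

Lemma stepf_kstep n m z x : stepf n (pn m ^~ z) x = pn (n + m) x z.
Proof. by rewrite kstepD. Qed.

Lemma stepf_delta n z x : stepf n (fun y => (y == z)%:R) x = pn n x z.
Proof. by rewrite -{2}(addn0 n) kstepD. Qed.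

(** For two points or more this is the Two-Points Condition; a single point is
nearest to any boundary vertex, which is why one must exist. *)
Lemma extreme_exists (b0 : B) (S : {set X}) : S != finset.set0 ->
  exists x, extreme bd e S x.
Proof.
have [/edge_two_points[x [y [_ Sx _]]]|] := leqP 2 #|S|; first by exists x.
rewrite ltnS => S1 /set0Pn[x Sx]; exists x; split=> //; exists b0 => y Sy nyx.
by move/card_le1_eqP: S1 => /(_ _ _ Sx Sy) xy; rewrite xy eqxx in nyx.
Qed.

(** Extreme points never run out, so what is preserved by removing them can be carried
from the set of all vertices down to the empty set. *)
Lemma peel_ind (b0 : B) (Q : {set X} -> Prop) :
    Q [set: X]%SET ->
    (forall S x, extreme bd e S x -> Q S -> Q (S :\ x)) ->
  Q finset.set0.
Proof.
move=> QT Qpeel.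
suff H n : forall S : {set X}, #|S| = n -> Q S -> Q finset.set0 by exact: H QT.
elim: n => [|n IH] S cS QS; first by rewrite -(cards0_eq cS).
have /(extreme_exists b0)[x Sx] : S != finset.set0 by rewrite -card_gt0 cS.
apply: (IH (S :\ x)); last exact: Qpeel.
by case: Sx => xS _; move: cS; rewrite (cardsD1 x) xS => -[].
Qed.

(** This is where two extreme points are used rather than one: x can be kept while
all the other points are removed. *)
Lemma extreme_other (S : {set X}) x : x \in S -> (2 <= #|S|)%N ->
  exists2 y, y != x & extreme bd e S y.
Proof.
move=> xS /edge_two_points[y [z [nyz Sy Sz]]].
have [yx|?] := eqVneq y x; last by exists y.
by exists z; rewrite // -yx eq_sym.
Qed.

(** A signal from S that reaches b at the earliest possible time comes from the
nearest point only, so nothing can cancel it. *)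
Lemma stepf_nearest (S : {set X}) f b x :
    (forall y, y \notin S -> f y = 0) ->
    (forall y, y \in S -> y != x -> (gd (bd b) x < gd (bd b) y)%N) ->
  stepf (gd (bd b) x) f (bd b) = pn (gd (bd b) x) (bd b) x * f x.
Proof.
move=> f0 near; rewrite /stepf (bigD1 x)//= big1 ?addr0// => y nyx.
have [yS|/f0->] := boolP (y \in S); last by rewrite mulr0.
by rewrite kstep_eq0 ?mul0r//; apply: near.
Qed.

(** The hypothesis says that f sends no signal to any b before delta_x does.  Keep a
set S that contains x and the support of f.  An extreme point of S other than x
is closer than x to its boundary vertex, so f vanishes there, and S shrinks
until only x is left. *)
Lemma early_silence_supp f x :
    (forall b k, (k < gd (bd b) x)%N -> stepf k f (bd b) = 0) ->
  forall y, y != x -> f y = 0.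
Proof.
move=> f0.
suff H n : forall S : {set X}, #|S| = n -> x \in S ->
    (forall y, y \notin S -> f y = 0) -> forall y, y != x -> f y = 0.
  by apply: (H _ [set: X]%SET erefl); rewrite ?inE// => y; rewrite inE.
elim: n => [|n IH] S cS xS fS y nyx.
  by move: xS; rewrite (cards0_eq cS) inE.
have [S1|] := leqP #|S| 1.
  have [yS|/fS//] := boolP (y \in S).
  by move/card_le1_eqP: S1 => /(_ _ _ xS yS) xy; rewrite xy eqxx in nyx.
case/(extreme_other xS) => z nzx [zS [b near]].
have fz : f z = 0.
  have := f0 b (gd (bd b) z); rewrite (stepf_nearest fS near).
  move=> /(_ (near _ xS _)); rewrite eq_sym => /(_ nzx) /eqP.
  by rewrite mulf_eq0 gt_eqF ?kstep_gdist_gt0// => /eqP.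
apply: (IH (S :\ z)) => //.
- by move: cS; rewrite (cardsD1 z) zS => -[].
- by rewrite !inE eq_sym nzx.
- by move=> w; rewrite !inE negb_and negbK => /orP[/eqP ->//|/fS].
Qed.

(** By the previous lemma the support of f is contained in {x} for an arbitrary x,
and the signal of delta_x does reach the boundary. *)
Lemma observable (b0 : B) f :
  (forall b k, stepf k f (bd b) = 0) -> forall x, f x = 0.
Proof.
move=> f0 x; have fx := early_silence_supp (fun b k _ => f0 b k) (x := x).
have := f0 b0 (gd (bd b0) x); rewrite /stepf (bigD1 x)//= big1 ?addr0.
  by move=> /eqP; rewrite mulf_eq0 gt_eqF ?kstep_gdist_gt0// => /eqP.
by move=> y /fx ->; rewrite mulr0.
Qed.

End Network.

(** * Functions on two networks with the same boundary data *)

Section SameData.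
Context (R : realType) (B : finType).
Implicit Types G : netwalk R B.

Lemma stepf_lin G (I : finType) (a : I -> R) (F : I -> vert G -> R) n x :
  stepf n (fun y => \sum_i a i * F i y) x = \sum_i a i * stepf n (F i) x.
Proof.
rewrite /stepf; under eq_bigr do rewrite mulr_sumr.
rewrite exchange_big; apply: eq_bigr => i _; rewrite mulr_sumr.
by apply: eq_bigr => y _; rewrite mulrCA.
Qed.

Definition same_kernel G G' : Prop := forall n b c,
  kstep (@trans R B G) n (bdry G b) (bdry G c) =
  kstep (@trans R B G') n (bdry G' b) (bdry G' c).

Definition same_data G G' (f : vert G -> R) (f' : vert G' -> R) : Prop :=
  forall n b, stepf n f (bdry G b) = stepf n f' (bdry G' b).

Lemma same_data_sym G G' (f : vert G -> R) (f' : vert G' -> R) :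
  same_data f f' -> same_data f' f.
Proof. by move=> ff' n b. Qed.

Lemma eq_same_data G G' (f g : vert G -> R) (f' g' : vert G' -> R) :
  f =1 g -> f' =1 g' -> same_data f f' -> same_data g g'.
Proof. by move=> /funext -> /funext ->. Qed.

Lemma same_data_lin G G' (I : finType) (a : I -> R)
    (F : I -> vert G -> R) (F' : I -> vert G' -> R) :
  (forall i, same_data (F i) (F' i)) ->
  same_data (fun x => \sum_i a i * F i x) (fun x => \sum_i a i * F' i x).
Proof.
by move=> FF' n b; rewrite !stepf_lin; apply: eq_bigr => i _; rewrite FF'.
Qed.

Lemma same_data_scale G G' (a : R) (f : vert G -> R) (f' : vert G' -> R) :
  same_data f f' -> same_data (fun x => a * f x) (fun x => a * f' x).
Proof.
move=> ff' n b; rewrite /stepf.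
under eq_bigr do rewrite mulrCA.
under [RHS]eq_bigr do rewrite mulrCA.
by rewrite -!mulr_sumr; congr (_ * _); exact: ff'.
Qed.

Lemma same_data_sub G G' (f g : vert G -> R) (f' g' : vert G' -> R) :
  same_data f f' -> same_data g g' ->
  same_data (fun x => f x - g x) (fun x => f' x - g' x).
Proof.
move=> ff' gg' n b; rewrite /stepf.
under eq_bigr do rewrite mulrBr.
under [RHS]eq_bigr do rewrite mulrBr.
by rewrite !sumrB; congr (_ - _); [exact: ff'|exact: gg'].
Qed.

Lemma same_data_unique (b0 : B) G G' (f : vert G -> R) (f' g' : vert G' -> R) :
  same_data f f' -> same_data f g' -> f' = g'.
Proof.
move=> ff' fg'; apply/funext => x; apply/eqP; rewrite -subr_eq0; apply/eqP.
apply: (@observable _ _ G' b0 (fun x => f' x - g' x)) => b k.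
have := same_data_sub (same_data_sym ff') (same_data_sym fg') k b.
move=> ->; rewrite /stepf big1// => y _; rewrite subrr mulr0//.
Qed.

Lemma same_data_kstep G G' m b : same_kernel G G' ->
  same_data (fun x => kstep (@trans R B G) m x (bdry G b))
            (fun x => kstep (@trans R B G') m x (bdry G' b)).
Proof. by move=> GG' n c; rewrite !stepf_kstep GG'. Qed.

(** Peeling, with the induction hypothesis that the indicators of the points already
removed have partners.  When x is removed because it is nearest to c, at distance
k, the function P^k delta_c is the sum of a nonzero multiple of delta_x and of
multiples of indicators of removed points; it has the partner P'^k delta_c, so
delta_x has a partner too. *)
Lemma same_data_total (b0 : B) G G' : same_kernel G G' ->
  forall z : vert G, exists f' : vert G' -> R, same_data (fun x => (x == z)%:R) f'.
Proof.
move=> GG'.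
pose Q (S : {set vert G}) := forall z, z \notin S ->
  exists f' : vert G' -> R, same_data (fun x => (x == z)%:R) f'.
suff Q0 : Q finset.set0 by move=> z; apply: Q0; rewrite inE.
apply: (peel_ind b0) => [z|S x [xS [c near]] TS z]; first by rewrite inE.
rewrite !inE negb_and negbK => /orP[/eqP->{z}|]; last exact: TS.
have /choice[F TF] : forall z, exists f' : vert G' -> R,
    same_data (fun x => (z \notin S)%:R * (x == z)%:R) f'.
  move=> z; have [zS|/TS[f' Tf']] := boolP (z \in S).
    exists (fun=> 0) => m b; rewrite /stepf !big1// => y _; first by rewrite mulr0.
    by rewrite mul0r mulr0.
  by exists (fun v => 1 * f' v); exact: same_data_scale.
set k := gdist (@edge R B G) (bdry G c) x.
pose h z := kstep (@trans R B G) k z (bdry G c).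
have hx : h x != 0 by rewrite gt_eqF// kstep_to_gt0.
have h0 z : z \in S -> z != x -> h z = 0.
  by move=> zS nzx; apply: kstep_to_eq0; exact: near.
have := same_data_scale (h x)^-1
  (same_data_sub (same_data_kstep k c GG') (same_data_lin h TF)).
move=> Trest; eexists; apply: eq_same_data Trest => [y|v]; last by [].
rewrite -/(h y).
under eq_bigr do rewrite mulrA.
rewrite (sum_delta (fun z => h z * (z \notin S)%:R)).
have [yS|yS] := boolP (y \in S); last first.
  by rewrite mulr1 subrr mulr0; case: eqP => // yx; rewrite yx xS in yS.
rewrite /= mulr0 subr0; case: eqVneq => [->|nyx]; first by rewrite mulVf.
by rewrite (h0 y)// mulr0.
Qed.

End SameData.

(** * The network is determined by its boundary kernel *)

Section Reconstruction.
Context (R : realType) (B : finType) (b0 : B) (G G' : netwalk R B).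
Hypothesis GG' : same_kernel G G'.
Local Notation X := (vert G).
Local Notation X' := (vert G').
Local Notation gd := (gdist (@edge R B G)).
Local Notation pn := (kstep (@trans R B G)).
Local Notation pn' := (kstep (@trans R B G')).

Let G'G : same_kernel G' G. Proof. by move=> n b c; rewrite GG'. Qed.

(** Since f' is nonnegative and sends no signal to b before time d(b, x), neither does
the indicator of a point u of its support.  By [early_silence_supp] the partner of
that indicator is a multiple of the indicator of x, so f' is a multiple of the
indicator of u. *)
Lemma same_data_nonneg_delta (x : X) (f' : X' -> R) :
    same_data (fun y => (y == x)%:R) f' -> (forall u, 0 <= f' u) ->
  exists2 u, 0 < f' u & forall v, v != u -> f' v = 0.
Proof.
move=> Tf' f'0.
have [u fu] : exists u, f' u != 0.
  apply: contrapT => /forallNP h.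
  have f'E : f' = fun=> 0.
    by apply/funext => u; have /negP := h u; rewrite negbK => /eqP.
  have := Tf' (gd (bdry G b0) x) b0.
  rewrite stepf_delta f'E /stepf big1 => [|y _]; last by rewrite mulr0.
  by move/eqP; rewrite gt_eqF// kstep_gdist_gt0.
exists u; first by rewrite lt_neqAle eq_sym fu f'0.
have [g Tg] := same_data_total b0 G'G u.
have g0 : forall y, y != x -> g y = 0.
  apply: early_silence_supp => b k ltk.
  rewrite -Tg stepf_delta; apply/eqP.
  have := Tf' k b; rewrite stepf_delta kstep_eq0// /stepf => /esym/eqP.
  rewrite psumr_eq0; last first.
    by move=> v _; rewrite mulr_ge0//; apply/kstep_ge0/trans_ge0.
  by move=> /allP/(_ u); rewrite mem_index_enum => /(_ isT); rewrite mulf_eq0 (negPf fu) orbF.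
have gE : g = fun y => g x * (y == x)%:R.
  apply/funext => y; case: eqVneq => [->|/g0 ->]; first by rewrite mulr1.
  by rewrite mulr0.
have uE : (fun v => (v == u)%:R) = (fun v => g x * f' v).
  apply: (same_data_unique b0 (same_data_sym Tg)).
  by rewrite {1}gE; exact: same_data_scale.
move=> v nvu; have /= := congr1 (@^~ v) uE; have /= := congr1 (@^~ u) uE.
rewrite eqxx (negPf nvu) => gfu /esym/eqP; rewrite mulf_eq0 => /orP[/eqP gx|/eqP//].
by move/eqP: gfu; rewrite gx mul0r oner_eq0.
Qed.

(** The invariant of the peeling is that every removed y is matched with a point u,
and that the partner F z of each remaining z vanishes at u.  The latter is what
makes the partner of the next removed point nonnegative at the points matched
before. *)
Lemma same_data_delta (x : X) : exists u : X',
  exists2 a : R, 0 < a & same_data (fun y => (y == x)%:R) (fun v => a * (v == u)%:R).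
Proof.
have /choice[F TF] := same_data_total b0 GG'.
have FE (f : X -> R) (f' : X' -> R) : same_data f f' -> f' = fun v => \sum_z f z * F z v.
  move=> Tf; apply: (same_data_unique b0 Tf).
  by apply: eq_same_data (same_data_lin f TF) => // y; exact: sum_delta.
suff [u fu Fu] : exists2 u, 0 < F x u & forall v, v != u -> F x v = 0.
  exists u, (F x u) => //; apply: eq_same_data (TF x) => // v.
  by case: eqVneq => [->|/Fu ->]; rewrite ?mulr1 ?mulr0.
pose Q (S : {set X}) := forall y, y \notin S -> exists u, [/\ 0 < F y u,
  forall v, v != u -> F y v = 0 & forall z, z \in S -> F z u = 0].
suff Q0 : Q finset.set0.
  by have [|u [? ? _]] := Q0 x; [rewrite inE|exists u].
apply: (peel_ind b0) => [y|S w [wS [c near]] TS]; first by rewrite inE.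
set k := gd (bdry G c) w in near.
have pw0 : 0 < pn k w (bdry G c) by exact: kstep_to_gt0.
have pz0 z : z \in S -> z != w -> pn k z (bdry G c) = 0.
  by move=> zS nzw; apply: kstep_to_eq0; exact: near.
pose matched v := exists2 y, y \notin S & F y v != 0.
have matchedS v z : matched v -> z \in S -> F z v = 0.
  move=> [y yS Fyv] zS; have [u [_ Fyu Fzu]] := TS _ yS.
  have [vu|/Fyu] := eqVneq v u; first by rewrite vu Fzu.
  by move/eqP; rewrite (negPf Fyv).
(* P'^k delta_c is the partner of P^k delta_c, which on S lives at w only. *)
have colE v : ~ matched v -> pn' k v (bdry G' c) = pn k w (bdry G c) * F w v.
  move=> unmatched; have /= -> := congr1 (@^~ v) (FE _ _ (same_data_kstep k c GG')).
  rewrite (bigD1 w)//= big1 ?addr0// => z nzw.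
  have [zS|zS] := boolP (z \in S); first by rewrite pz0// mul0r.
  by have [->|Fz] := eqVneq (F z v) 0; [rewrite mulr0|case: unmatched; exists z].
have Fw_ge0 v : 0 <= F w v.
  have [/matchedS->//|/colE] := pselect (matched v).
  move=> h; rewrite -(pmulr_rge0 _ pw0) -h; exact/kstep_ge0/trans_ge0.
have [u Fwu Fw] := same_data_nonneg_delta (TF w) Fw_ge0.
move=> y; rewrite !inE negb_and negbK => /orP[/eqP->{y}|yS]; last first.
  have [v [? ? vS]] := TS _ yS; exists v; split=> // z; rewrite !inE => /andP[_].
  exact: vS.
exists u; split=> // z; rewrite !inE => /andP[nzw zS].
have unmatched : ~ matched u by move=> /matchedS/(_ wS)/eqP; rewrite gt_eqF.
(* At time k the signal of z has not reached c, whereas among the points where F z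
   might not vanish only u is seen from c at that time. *)
have := TF z k c; rewrite stepf_delta kstep_eq0; last exact: near.
rewrite /stepf (bigD1 u)//= big1 ?addr0; last first.
  move=> v nvu; have [/matchedS->//|/colE] := pselect (matched v); first by rewrite mulr0.
  by rewrite Fw// mulr0 => /kstep_eq0C ->; rewrite mul0r.
move=> /esym/eqP; rewrite mulf_eq0 => /orP[/eqP/kstep_eq0C|/eqP//].
by rewrite colE// => /eqP; rewrite gt_eqF// mulr_gt0.
Qed.

Lemma same_kernel_equivalent_nonempty : equivalent G G'.
Proof.
have /choice[Phi /choice[a]] : forall x : X, exists u : X', exists a : R, 0 < a /\
    same_data (fun y => (y == x)%:R) (fun v => a * (v == u)%:R).
  by move=> x; have [u [a a0 Ta]] := same_data_delta x; exists u, a.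
move=> /all_and2[a_gt0 TPhi].
have FE (f : X -> R) (f' : X' -> R) : same_data f f' ->
    forall v, f' v = \sum_z f z * (a z * (v == Phi z)%:R).
  move=> Tf v; have TF := same_data_lin f TPhi.
  suff -> : f' = fun v => \sum_z f z * (a z * (v == Phi z)%:R) by [].
  apply: (same_data_unique b0 Tf).
  by apply: eq_same_data TF => // y; exact: sum_delta.
have Phi_inj : injective Phi.
  move=> x y Phixy.
  have := same_data_sub (same_data_scale (a x)^-1 (TPhi x)) (same_data_scale (a y)^-1 (TPhi y)).
  rewrite Phixy => /same_data_sym.
  set f' := (fun v => _ - _); have f'0 : f' = fun=> 0.
    by apply/funext => v; rewrite /f' !mulrA !mulVf ?gt_eqF// subrr.
  rewrite f'0 => h.
  have T0 : same_data (fun _ : X' => 0 : R) (fun _ : X => 0 : R).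
    by move=> n b; rewrite /stepf !big1// => ? _; rewrite mulr0.
  have /= := congr1 (@^~ x) (same_data_unique b0 h T0).
  rewrite eqxx mulr1; case: eqVneq => // _ /eqP.
  by rewrite mulr0 subr0 invr_eq0 gt_eqF.
have coordE (f : X -> R) (f' : X' -> R) : same_data f f' -> forall x, f' (Phi x) = f x * a x.
  move=> Tf x; rewrite (FE _ _ Tf) (bigD1 x)//= eqxx mulr1 big1 ?addr0// => z nzx.
  by rewrite (inj_eq Phi_inj) eq_sym (negPf nzx) !mulr0.
(* Rows of P^n sum to 1, so constants have the same data; this fixes the scale. *)
have T1 : same_data (fun _ : X => 1 : R) (fun _ : X' => 1 : R).
  move=> n b; rewrite /stepf; under eq_bigr do rewrite mulr1.
  under [RHS]eq_bigr do rewrite mulr1.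
  by rewrite !kstep_sum1//; exact: trans_sum1.
have a1 x : a x = 1 by have := coordE _ _ T1 x; rewrite mul1r.
have Phi_surj v : exists x, Phi x = v.
  apply: contrapT => /forallNP nov; have /eqP := FE _ _ T1 v.
  rewrite big1 ?oner_eq0// => z _; case: eqVneq => [vz|]; last by rewrite !mulr0.
  by case: (nov z).
have [Psi PsiK] := choice Phi_surj.
have Phi_trans x y : trans (Phi x) (Phi y) = trans x y.
  (* Applying P shifts the data by one time step, so it respects partners. *)
  have Tcol : same_data (fun z => trans z y) (fun v => @trans R B G' v (Phi y)).
    move=> n b; rewrite /stepf -!kstepS_last.
    rewrite -[LHS]stepf_delta -[RHS]stepf_delta (TPhi y).
    by congr stepf; apply/funext => v; rewrite a1 mul1r.
  by rewrite (coordE _ _ Tcol) a1 mulr1.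
exists Phi; split=> //.
- by exists Psi => // x; apply: Phi_inj; rewrite PsiK.
- by move=> x y; rewrite !edge_trans Phi_trans (inj_eq Phi_inj).
- move=> b; apply/eqP.
  have := coordE _ _ (same_data_kstep 0 b GG') (bdry G b).
  rewrite /= eqxx a1 mulr1; case: eqP => // _ /eqP.
  by rewrite eq_sym oner_eq0.
Qed.

End Reconstruction.

(** * The Markov property for events in the past *)

Section FiniteValued.
Context (R : realType) (d : measure_display) (Omega : measurableType d)
  (P : probability Omega R).
Local Notation mu A := (fine (P A)).

Lemma fine_prob_ge0 A : 0 <= mu A.
Proof. exact/fine_ge0/measure_ge0. Qed.

Lemma fine_prob_partition (T : finType) (Z : Omega -> T) (C : set Omega) :
    (forall z, measurable [set w | Z w = z]) -> measurable C ->
  mu C = \sum_z mu (C `&` [set w | Z w = z]).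
Proof.
move=> mZ mC; have mCZ z : measurable (C `&` [set w | Z w = z]) by exact: measurableI.
rewrite sum_fine => [|z _]; last exact: fin_num_measure.
congr fine; rewrite fsbig_seq ?index_enum_uniq//.
rewrite (_ : [set` index_enum T] = [set: T]); last first.
  by apply/seteqP; split=> // z _ /=; rewrite mem_index_enum.
rewrite -measure_fin_bigcup; last first.
- by [].
- by move=> z z' _ _ [w [[_ <-] [_ <-]]].
- exact: finite_finset.
by congr (P _); apply/seteqP; split=> [w Cw|w [z _ []]//]; exists (Z w).
Qed.

End FiniteValued.

Section Chain.
Context (R : realType) (d : measure_display) (Omega : measurableType d)
  (P : probability Omega R) (X : finType) (p : X -> X -> R) (x0 : X)
  (H : nat -> Omega -> X).
Hypothesis mc : markov_chain P p x0 H.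
Local Notation mu A := (fine (P A)).

(** The first N + 1 positions.  Expectations of quantities that depend on them are
finite sums over the values of this random variable. *)
Definition traj (N : nat) (w : Omega) : {ffun 'I_N.+1 -> X} := [ffun i : 'I_N.+1 => H i w].

Lemma traj_at N t w : (t <= N)%N -> traj N w (inord t) = H t w.
Proof. by move=> tN; rewrite ffunE inordK. Qed.

Lemma traj_eqP N w w' :
  traj N w = traj N w' <-> forall t, (t <= N)%N -> H t w = H t w'.
Proof.
split=> [ww' t tN|ww']; first by rewrite -!(traj_at _ tN) ww'.
by apply/ffunP => i; rewrite !ffunE ww'// -ltnS.
Qed.

Lemma measurable_traj N q : measurable [set w | traj N w = q].
Proof.
rewrite (_ : [set w | _] = \bigcap_(i in [set: 'I_N.+1]) [set w | H i w = q i]).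
  by apply: fin_bigcap_measurable => // i _; exact: (chain_measurable mc).
apply/seteqP; split=> [w <- i _ /=|w wq]; first by rewrite ffunE.
by apply/ffunP => i; rewrite ffunE; exact: wq.
Qed.

(** The events A in the sigma-algebra generated by H_0, ..., H_N. *)
Definition determined (N : nat) (A : set Omega) : Prop :=
  forall w w', traj N w = traj N w' -> A w -> A w'.

Lemma determined_measurable N A : determined N A -> measurable A.
Proof.
move=> dA.
rewrite (_ : A = \bigcup_(q in [set traj N w | w in A]) [set w | traj N w = q]).
  by apply: fin_bigcup_measurable => // q _; exact: measurable_traj.
apply/seteqP; split=> [w Aw|w [_ [w' Aw' <-]] /esym/dA]; last exact.
by exists (traj N w) => //; exists w.
Qed.

Lemma determined_le M N A : (M <= N)%N -> determined M A -> determined N A.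
Proof.
move=> MN dA w w' /traj_eqP ww'; apply: dA; apply/traj_eqP => t tM.
by apply: ww'; rewrite (leq_trans tM).
Qed.

Lemma determinedI N A C : determined N A -> determined N C -> determined N (A `&` C).
Proof. by move=> dA dC w w' ww' [Aw Cw]; split; [exact: dA ww' _|exact: dC ww' _]. Qed.

Lemma determined_at N t x : (t <= N)%N -> determined N [set w | H t w = x].
Proof. by move=> tN w w' /traj_eqP/(_ _ tN) /= ->. Qed.

Lemma markov_traj s (q : {ffun 'I_s.+1 -> X}) y :
  mu ([set w | traj s w = q] `&` [set w | H s.+1 w = y]) =
  mu [set w | traj s w = q] * p (q ord_max) y.
Proof.
pose h t := q (inord t).
have pastE : [set w | forall t, (t <= s)%N -> H t w = h t] = [set w | traj s w = q].
  apply/seteqP; split=> w /= wq.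
    by apply/ffunP => i; rewrite ffunE wq ?/h ?inord_val// -ltnS.
  by move=> t ts; rewrite /h -wq traj_at.
have hs : h s = q ord_max by rewrite /h; congr (q _); apply: val_inj; rewrite /= inordK.
have mq := measurable_traj q.
have my : measurable [set w | H s.+1 w = y] by exact: (chain_measurable mc).
have [q0|] := boolP (P [set w | traj s w = q] == 0%E).
  rewrite (eqP q0) mul0r [X in fine X](_ : _ = 0%E)//; apply/eqP.
  by rewrite -measure_le0 -(eqP q0) le_measure ?inE//; exact: measurableI.
rewrite -measure_gt0 => Pq.
have := @chain_markov _ _ _ _ _ _ _ _ mc s h y; rewrite /= pastE => /(_ Pq).
have PHs : (0 < P [set w | H s w = h s])%E.
  apply: lt_le_trans Pq _; apply: le_measure; rewrite ?inE//.
    exact: (chain_measurable mc).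
  by move=> w /= wq; rewrite hs -wq ffunE.
rewrite (chain_trans mc y PHs) hs /cprob => <-.
rewrite setIC mulrC divfK// gt_eqF// fine_gt0// Pq /=.
by rewrite (le_lt_trans (probability_le1 P mq))// ltry.
Qed.

(** Each trajectory up to time s is either contained in A with last position x or
disjoint from that event, so the property for single trajectories adds up. *)
Lemma markov_step s A x y : determined s A ->
  mu (A `&` [set w | H s w = x] `&` [set w | H s.+1 w = y]) =
  mu (A `&` [set w | H s w = x]) * p x y.
Proof.
move=> dA; have dAx := determinedI dA (determined_at (x := x) (leqnn s)).
have mA := determined_measurable dAx.
have my : measurable [set w | H s.+1 w = y] by exact: (chain_measurable mc).
rewrite (fine_prob_partition P (measurable_traj (N:=s)) mA).
rewrite (fine_prob_partition P (measurable_traj (N:=s)) (measurableI _ _ mA my)).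
rewrite mulr_suml; apply: eq_bigr => q _.
have [[w [Aw wq]]|Aq] := pselect (exists w, (A `&` [set w | H s w = x]) w /\ traj s w = q).
  have qA : [set w | traj s w = q] `<=` A `&` [set w | H s w = x].
    by move=> w' /= w'q; apply: dAx Aw; rewrite wq w'q.
  rewrite (setIidr qA) setIAC (setIidr qA) markov_traj.
  by have [_ <-] := Aw; rewrite -wq ffunE.
rewrite [A `&` _ `&` [set w | traj s w = q]](_ : _ = set0); last first.
  by apply/seteqP; split=> // w [Aw wq]; apply: Aq; exists w.
rewrite [X in P X](_ : _ = set0) ?measure0 ?mul0r//.
by apply/seteqP; split=> // w [[Aw _] wq]; apply: Aq; exists w.
Qed.

Lemma markov_kstep s n A x y : determined s A ->
  mu (A `&` [set w | H s w = x] `&` [set w | H (s + n) w = y]) =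
  mu (A `&` [set w | H s w = x]) * kstep p n x y.
Proof.
move=> dA; have dAx := determinedI dA (determined_at (x := x) (leqnn s)).
elim: n y => [|n IH] y.
  rewrite addn0 /=; have [->|nxy] := eqVneq x y.
    by rewrite mulr1 -setIA setIid.
  rewrite mulr0 [X in P X](_ : _ = set0) ?measure0//.
  by apply/seteqP; split=> // w [[_ /= ->]] /eqP; rewrite (negPf nxy).
have mH z : measurable [set w | H (s + n) w = z] by exact: (chain_measurable mc).
rewrite (fine_prob_partition P mH); last first.
  apply: measurableI; first exact: determined_measurable dAx.
  exact: (chain_measurable mc).
rewrite kstepS_last mulr_sumr; apply: eq_bigr => z _.
by rewrite setIAC addnS markov_step ?IH ?mulrA//; apply: determined_le dAx; lia.
Qed.

(** * Second moments of the deviations *)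

Definition expect (N : nat) (g : {ffun 'I_N.+1 -> X} -> R) : R :=
  \sum_q mu [set w | traj N w = q] * g q.

Lemma expect_le N g h : (forall q, g q <= h q) -> expect (N := N) g <= expect h.
Proof. by move=> gh; apply: ler_sum => q _; rewrite ler_wpM2l ?fine_prob_ge0. Qed.

Lemma expect_sum N (I : finType) (g : I -> {ffun 'I_N.+1 -> X} -> R) :
  expect (fun q => \sum_i g i q) = \sum_i expect (g i).
Proof.
rewrite /expect; under eq_bigr do rewrite mulr_sumr.
by rewrite exchange_big.
Qed.

Lemma expect_lin N a b (g h : {ffun 'I_N.+1 -> X} -> R) :
  expect (fun q => a * g q + b * h q) = a * expect g + b * expect h.
Proof.
rewrite /expect !mulr_sumr -big_split; apply: eq_bigr => q _ /=.
by rewrite mulrDr !(mulrCA (mu _)).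
Qed.

Lemma expect_pred N (b : pred {ffun 'I_N.+1 -> X}) :
  expect (fun q => (b q)%:R) = mu [set w | b (traj N w)].
Proof.
rewrite [RHS](fine_prob_partition P (measurable_traj (N:=N))); last first.
  by apply: (@determined_measurable N) => w w' /= ->.
apply: eq_bigr => q _; case: (boolP (b q)) => bq.
  by rewrite mulr1; congr (mu _); apply/seteqP; split=> [w /= wq|w []//]; rewrite wq.
rewrite mulr0 [X in P X](_ : _ = set0) ?measure0//.
by apply/seteqP; split=> // w [/=] + wq; rewrite wq (negPf bq).
Qed.

Lemma expect1 N : expect (N := N) (fun=> 1) = 1.
Proof.
rewrite (expect_pred xpredT) [X in P X](_ : _ = setT) ?probability_setT//.
by apply/seteqP; split.
Qed.

(** How much a transition from x at time t to y at time t + n departs from its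
conditional expectation. *)
Definition deviation (n : nat) (x y : X) (N t : nat) (q : {ffun 'I_N.+1 -> X}) : R :=
  (q (inord t) == x)%:R * ((q (inord (t + n)) == y)%:R - kstep p n x y).

(** The deviation at time s is centred given any event b in the past of s. *)
Lemma expect_deviation n x y N s (b : pred {ffun 'I_N.+1 -> X}) :
    (s + n <= N)%N -> determined s [set w | b (traj N w)] ->
  expect (fun q => (b q)%:R * deviation n x y s q) = 0.
Proof.
move=> sN db; have sN' : (s <= N)%N by lia.
transitivity (expect (fun q => 1 * [&& b q, q (inord s) == x & q (inord (s + n)) == y]%:R
   + - kstep p n x y * (b q && (q (inord s) == x))%:R)).
  apply: eq_bigr => q _; congr (_ * _); rewrite /deviation.
  by case: (b q); case: (q (inord s) == x); case: (_ == y) => /=; ring.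
rewrite expect_lin !expect_pred mul1r mulNr; apply/eqP; rewrite subr_eq0 mulrC; apply/eqP.
rewrite -(_ : [set w | b (traj N w)] `&` [set w | H s w = x] =
    [set w | b (traj N w) && (traj N w (inord s) == x)]); last first.
  apply/seteqP; split=> w /=; rewrite traj_at//.
    by case=> -> ->; rewrite eqxx.
  by case/andP=> -> /eqP.
rewrite -markov_kstep//; congr (mu _); apply/seteqP; split=> w /=; rewrite !traj_at//.
  by case/and3P => -> /eqP-> /eqP.
by case=> -[-> ->] ->; rewrite !eqxx.
Qed.

(** The earlier deviation is a combination of two indicators of events in the past of
s, to which [expect_deviation] applies. *)
Lemma expect_deviationM n x y N s t : (t + n <= s)%N -> (s + n <= N)%N ->
  expect (fun q : {ffun 'I_N.+1 -> X} => deviation n x y t q * deviation n x y s q) = 0.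
Proof.
move=> ts sN.
transitivity (expect (fun q : {ffun 'I_N.+1 -> X} =>
    1 * (((q (inord t) == x) && (q (inord (t + n)) == y))%:R * deviation n x y s q)
   + - kstep p n x y * ((q (inord t) == x)%:R * deviation n x y s q))).
  apply: eq_bigr => q _; congr (_ * _).
  rewrite {1}/deviation.
  by case: (q (inord t) == x); case: (_ == y) => /=; ring.
rewrite expect_lin (expect_deviation x y (b := fun q : {ffun 'I_N.+1 -> X} =>
    (q (inord t) == x) && (q (inord (t + n)) == y)))//; last first.
  move=> w w' /traj_eqP ww' /=; rewrite !traj_at ?ww'//; lia.
rewrite (expect_deviation x y (b := fun q : {ffun 'I_N.+1 -> X} => q (inord t) == x))//.
  by rewrite !mulr0 addr0.
move=> w w' /traj_eqP ww' /=; rewrite !traj_at ?ww'//; lia.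
Qed.

Hypothesis p_ge0 : forall x y, 0 <= p x y.
Hypothesis p_sum1 : forall x, \sum_y p x y = 1.

Lemma norm_deviation_le1 n x y N t q : `|deviation (N := N) n x y t q| <= 1.
Proof.
have k0 := kstep_ge0 p_ge0 n x y; have k1 := kstep_le1 p_ge0 p_sum1 n x y.
rewrite /deviation; case: (_ == x); last by rewrite mul0r normr0.
by rewrite mul1r ler_norml; case: (_ == y) => /=; apply/andP; split; lra.
Qed.

Lemma count_near (T n s : nat) :
  (\sum_(t < T) ((s < t + n) && (t < s + n)) <= 2 * n)%N.
Proof.
rewrite -(big_mkord xpredT (fun t => ((s < t + n) && (t < s + n) : bool)%N : nat)).
rewrite /index_iota subn0 (eq_bigr (fun t => if ((s < t + n) && (t < s + n))%N then 1%N else 0%N)).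
  rewrite -big_mkcond sum1_count -size_filter -[leqRHS](size_iota (s - n)).
  apply: uniq_leq_size; first exact/filter_uniq/iota_uniq.
  by move=> t; rewrite mem_filter !mem_iota; lia.
by move=> t _; case: ifP.
Qed.

(** Only the pairs of times at distance less than n contribute, at most 1 each; there
are at most 2n of them for each s. *)
Lemma expect_sum_deviation_sqr n x y T :
  expect (fun q : {ffun 'I_(T + n).+1 -> X} => (\sum_(t < T) deviation n x y t q) ^+ 2)
  <= (2 * n * T)%:R.
Proof.
apply: (@le_trans _ _ (\sum_(s < T) \sum_(t < T)
   expect (fun q : {ffun 'I_(T + n).+1 -> X} => deviation n x y s q * deviation n x y t q))).
  rewrite le_eqVlt; apply/orP; left; apply/eqP.
  under [RHS]eq_bigr do rewrite -expect_sum.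
  rewrite -expect_sum; apply: eq_bigr => q _; congr (_ * _).
  by rewrite expr2 mulr_suml; apply: eq_bigr => s _; rewrite mulr_sumr.
apply: (@le_trans _ _ (\sum_(s < T) \sum_(t < T) ((s < t + n)%N && (t < s + n)%N)%:R)).
  apply: ler_sum => s _; apply: ler_sum => t _.
  have := ltn_ord s; have := ltn_ord t => tT sT.
  have [st|st] := ltnP s (t + n); last first.
    rewrite /= [leLHS](_ : _ = 0)// -(@expect_deviationM n x y (T + n) s t); [|lia|lia].
    by apply: eq_bigr => q _; rewrite (mulrC (deviation n x y s q)).
  have [ts|ts] := ltnP t (s + n); last first.
    by rewrite /= expect_deviationM//; lia.
  rewrite -[leRHS](expect1 (T + n)); apply: expect_le => q.
  rewrite (le_trans (ler_norm _))// normrM.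
  by rewrite mulr_ile1// norm_deviation_le1.
apply: (@le_trans _ _ (\sum_(s < T) (2 * n)%:R)).
  by apply: ler_sum => s _; rewrite -natr_sum ler_nat count_near.
by rewrite sumr_const card_ord -mulrnA.
Qed.

(** Chebyshev's inequality for the sum of the deviations. *)
Lemma prob_deviation_ge n x y T (eps : R) : 0 <= eps ->
  mu [set w | eps <= `|\sum_(t < T) (H t w == x)%:R * ((H (t + n) w == y)%:R - kstep p n x y)|]
     * eps ^+ 2 <= (2 * n * T)%:R.
Proof.
move=> eps0; apply: le_trans (expect_sum_deviation_sqr n x y T).
pose b (q : {ffun 'I_(T + n).+1 -> X}) := eps <= `|\sum_(t < T) deviation n x y t q|.
rewrite (_ : [set w | _] = [set w | b (traj (T + n) w)]); last first.
  apply/funext => w; congr (is_true (eps <= `|_|)); apply: eq_bigr => t _.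
  by rewrite /deviation !traj_at//; have := ltn_ord t; lia.
rewrite -expect_pred mulrC -[leLHS]addr0 -[X in _ + X](mul0r (expect (fun q : {ffun 'I_(T + n).+1 -> X} => 0))).
rewrite -expect_lin; apply: expect_le => q; rewrite mul0r addr0 /b.
case: (leP eps) => [le_eps|_]; last by rewrite mulr0 sqr_ge0.
by rewrite mulr1 -[leRHS]real_normK ?num_real// lerXn2r// ?nnegrE.
Qed.

End Chain.

(** * Almost every path is balanced *)

(** The sample times T_k = 2^k (k+1)^2 and the tolerances e_k = T_k / (k+1) are chosen
so that e_k = o(T_k) while the Chebyshev bounds 2n T_k / e_k^2 = 2n / 2^k are
summable. *)
Definition tolerance (k : nat) : nat := 2 ^ k * k.+1.
Definition sample_time (k : nat) : nat := tolerance k * k.+1.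

Definition imbalance (R : realType) (X : finType) (p : X -> X -> R) (n : nat)
    (x y : X) (T : nat) (h : nat -> X) : R :=
  \sum_(t < T) (h t == x)%:R * ((h (t + n)%N == y)%:R - kstep p n x y).

(** The frequencies of transitions agree with the n-step probabilities up to o(T),
along the sample times. *)
Definition balanced (R : realType) (X : finType) (p : X -> X -> R) (h : nat -> X) : Prop :=
  forall n x y, \forall k \near \oo,
    `|imbalance p n x y (sample_time k) h| <= (tolerance k)%:R.

Lemma tolerance_gt0 k : (0 < tolerance k)%N.
Proof. by rewrite muln_gt0 expn_gt0. Qed.

Section AlmostSurely.
Context (R : realType) (d : measure_display) (Omega : measurableType d)
  (P : probability Omega R) (X : finType) (p : X -> X -> R) (x0 : X)
  (H : nat -> Omega -> X).
Hypothesis mc : markov_chain P p x0 H.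
Hypothesis p_ge0 : forall x y, 0 <= p x y.
Hypothesis p_sum1 : forall x, \sum_y p x y = 1.

(** Chebyshev's bounds are summable along the sample times, so the Borel-Cantelli lemma
applies to each n, x and y; there are countably many of them. *)
Lemma ae_balanced : {ae P, forall w, balanced p (H^~ w)}.
Proof.
suff ae1 n x y : {ae P, forall w, \forall k \near \oo,
    `|imbalance p n x y (sample_time k) (H^~ w)| <= (tolerance k)%:R}.
  apply: ae_foralln => n; apply: filter_forall => x; apply: filter_forall => y.
  exact: ae1.
pose F k := [set w | (tolerance k)%:R <= `|imbalance p n x y (sample_time k) (H^~ w)|].
have mF k : measurable (F k).
  apply: (determined_measurable mc (N := sample_time k + n)) => w w' /traj_eqP ww'.
  rewrite /F /= (_ : imbalance _ _ _ _ _ (H^~ w) = imbalance p n x y (sample_time k) (H^~ w'))//.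
  by apply: eq_bigr => t _; rewrite !ww'//; have := ltn_ord t; lia.
(* This is 2n / 2^k; the index k + 1 gives a geometric series with sum 4n. *)
have PF k : (P (F k) <= ((4 * n)%:R / (2 ^ k.+1)%:R)%:E)%E.
  rewrite -[P _]fineK ?fin_num_measure// lee_fin.
  have := prob_deviation_ge mc p_ge0 p_sum1 n x y (sample_time k) (ler0n R (tolerance k)).
  rewrite -/(F k) -natrX => PF.
  have t0 : 0 < ((tolerance k) ^ 2)%:R :> R by rewrite ltr0n expn_gt0 tolerance_gt0.
  rewrite ler_pdivlMr ?ltr0n ?expn_gt0// -(ler_pM2r t0) mulrAC.
  apply: le_trans (ler_wpM2r (ler0n _ _) PF) _.
  rewrite -!natrM ler_nat /sample_time /tolerance expnS; nia.
exists (lim_sup_set F); split.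
- apply: bigcap_measurable => // k _; apply: bigcup_measurable => j _; exact: mF.
- apply: lim_sup_set_cvg0 => //.
  apply: le_lt_trans (ltry (4 * n)%:R); apply: le_trans (epsilon_trick0 xpredT (ler0n R (4 * n))).
  by apply: lee_nneseries => *; [exact: measure_ge0|exact: PF].
- move=> w /= nbal k _; apply: contrapT => nF; apply: nbal.
  exists k => // j /= kj; rewrite leNgt; apply/negP => /ltW Fj; apply: nF.
  by exists j.
Qed.

End AlmostSurely.

(** * A balanced path visits every vertex a positive proportion of the time *)

Section Recurrence.
Context (R : realType) (B : finType) (G : netwalk R B).
Local Notation X := (vert G).
Local Notation p := (@trans R B G).
Local Notation pn := (kstep p).

Definition visits (x : X) (T : nat) (h : nat -> X) : R := \sum_(t < T) (h t == x)%:R.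

Lemma sum_visits T h : \sum_x visits x T h = T%:R.
Proof.
rewrite /visits exchange_big /= (eq_bigr (fun=> 1)) => [|t _].
  by rewrite sumr_const card_ord.
by rewrite (bigD1 (h t))//= eqxx big1 ?addr0// => x; rewrite eq_sym => /negPf ->.
Qed.

Lemma visits_shift n y T h :
  \sum_(t < T) (h (t + n)%N == y)%:R <= visits y T h + n%:R.
Proof.
elim: n => [|n IH]; first by rewrite addr0; under eq_bigr do rewrite addn0.
have S m : \sum_(t < T.+1) (h (t + m)%N == y)%:R =
    \sum_(t < T) (h (t + m)%N == y)%:R + (h (T + m)%N == y)%:R :> R by rewrite big_ord_recr.
have := S n; rewrite big_ord_recl /=.
under eq_bigr do rewrite /bump add1n addSnnS.
move=> E; have h1 : (h (T + n)%N == y)%:R <= 1 :> R by case: (_ == _).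
have h0 : 0 <= (h (0 + n)%N == y)%:R :> R by [].
by rewrite mulrSr; lra.
Qed.

Lemma sum_imbalance n y T h :
  \sum_x imbalance p n x y T h =
  \sum_(t < T) (h (t + n)%N == y)%:R - \sum_x visits x T h * pn n x y.
Proof.
under eq_bigr do rewrite /imbalance (eq_bigr _ (fun t _ => mulrBr _ _ _)) sumrB -mulr_suml.
rewrite sumrB exchange_big; congr (_ - _); apply: eq_bigr => t _ /=.
rewrite (bigD1 (h t))//= eqxx mul1r big1 ?addr0// => x.
by rewrite eq_sym => /negPf ->; rewrite mul0r.
Qed.

(** By connectedness y is reached from x with positive probability in exactly d(x, y)
steps, which is at most the number of vertices. *)
Lemma occupation_lower y : exists2 e : R, 0 < e &
  forall x, e <= \sum_(n < #|X|.+1) pn n x y.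
Proof.
pose f x := \sum_(n < #|X|.+1) pn n x y.
exists (f [arg min_(x < y) f x]%O); last by move=> x; case: arg_minP => // i _; exact.
have fgt0 x : 0 < f x.
  have lt_d : (gdist (@edge R B G) x y < #|X|.+1)%N.
    by rewrite ltnS -[X in (_ <= X)%N](size_iota 0) find_size.
  rewrite /f (bigD1 (Ordinal lt_d))//= ltr_pwDl ?kstep_gdist_gt0//.
  by apply: sumr_ge0 => n _; apply: kstep_ge0; exact: trans_ge0.
exact: fgt0.
Qed.

(** For each n, the visits to y are, up to n + o(T), the visits to the vertices x
weighted by the n-step probabilities from x to y.  Summed over the n at most the
number of vertices, these weights are bounded below by [occupation_lower], and
the visits to all vertices add up to T. *)
Lemma balanced_recurrent h y : balanced p h ->
  exists2 e : R, 0 < e &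
    \forall k \near \oo, e * (sample_time k)%:R <= visits y (sample_time k) h.
Proof.
move=> bal; have [e e0 le_e] := occupation_lower y.
pose K := #|X|.+1.
have K0 : 0 < K%:R :> R by rewrite ltr0n.
(* Half of the proportion e / K that the balance gives: the rest absorbs the error. *)
pose e' := e / (2 * K%:R).
have e'0 : 0 < e' by rewrite divr_gt0// mulr_gt0.
exists e' => //.
have balK : \forall k \near \oo, forall (n : 'I_K) (x : X),
    `|imbalance p n x y (sample_time k) h| <= (tolerance k)%:R.
  by apply: filter_forall => n; apply: filter_forall => x; exact: bal.
near=> k.
have balk : forall (n : 'I_K) (x : X),
    `|imbalance p n x y (sample_time k) h| <= (tolerance k)%:R by near: k.
set T := sample_time k; set N := visits y T h.
have bound n : (n < K)%N ->
    \sum_x visits x T h * pn n x y <= N + 2 * K%:R * (tolerance k)%:R.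
  move=> nK.
  have sh := visits_shift n y T h.
  have nt : n%:R <= K%:R * (tolerance k)%:R :> R.
    rewrite -natrM ler_nat; have := tolerance_gt0 k; nia.
  have : - (\sum_x imbalance p n x y T h) <= K%:R * (tolerance k)%:R.
    rewrite (le_trans (ler_norm _))// normrN (le_trans (ler_norm_sum _ _ _))//.
    apply: (@le_trans _ _ (\sum_(x : X) (tolerance k)%:R)).
      by apply: ler_sum => x _; exact: (balk (Ordinal nK) x).
    rewrite sumr_const -[leLHS]mulr_natl ler_wpM2r// ler_nat; exact: leqnSn.
  rewrite sum_imbalance /N; lra.
have total : e * T%:R <= K%:R * (N + 2 * K%:R * (tolerance k)%:R).
  rewrite -(sum_visits T h) mulr_sumr.
  apply: (@le_trans _ _ (\sum_(n < K) \sum_x visits x T h * pn n x y)).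
    rewrite exchange_big; apply: ler_sum => x _ /=; rewrite -mulr_sumr mulrC.
    by apply: ler_wpM2l; rewrite ?le_e// sumr_ge0.
  rewrite mulr_natl -[X in _ *+ X](card_ord K) -sumr_const.
  by apply: ler_sum => n _; exact: bound.
have kbig : 2 * K%:R / e' <= k%:R by near: k; exact: nbhs_infty_ger.
have tol : 2 * K%:R * (tolerance k)%:R <= e' * T%:R.
  move: kbig; rewrite ler_pdivrMr// => kbig.
  apply: le_trans (ler_wpM2r (ler0n _ _) kbig) _.
  have : 0 <= e' * (tolerance k)%:R by apply: mulr_ge0; [exact: ltW|exact: ler0n].
  by rewrite /T /sample_time natrM -(natr1 k); lra.
have : 2 * e' * T%:R <= N + 2 * K%:R * (tolerance k)%:R.
  rewrite -(ler_pM2l K0) (le_trans _ total)// le_eqVlt; apply/orP; left; apply/eqP.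
  by rewrite /e'; field; rewrite gt_eqF.
lra.
Unshelve. all: by end_near.
Qed.

End Recurrence.

(** * What the observed sequence reveals *)

Section Compatible.
Context (R : realType) (B : finType).
Implicit Types (G : netwalk R B) (s : nat -> option B).

(** The two properties of the observed sequence s that hold almost surely when it comes
from G; both are expressed by s and the boundary kernel of G alone. *)
Definition compatible s G : Prop :=
  (forall b, exists2 e : R, 0 < e & \forall k \near \oo,
     e * (sample_time k)%:R <= \sum_(t < sample_time k) (s t == Some b)%:R) /\
  (forall n b c, \forall k \near \oo,
     `|\sum_(t < sample_time k) (s t == Some b)%:R *
        ((s (t + n)%N == Some c)%:R - kstep (@trans R B G) n (bdry G b) (bdry G c))|
     <= (tolerance k)%:R).

Lemma observe_eq G x b : (observe (bdry G) x == Some b) = (x == bdry G b).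
Proof.
rewrite /observe; case: pickP => [c /eqP <-|nobs]; last by rewrite [RHS]eq_sym nobs.
by rewrite (inj_eq (@bdry_inj _ _ G)); apply/eqP/eqP => [[->]|->].
Qed.

Lemma balanced_compatible G (h : nat -> vert G) : balanced (@trans R B G) h ->
  compatible (fun t => observe (bdry G) (h t)) G.
Proof.
move=> bal; split=> [b|n b c].
  have [e e0 he] := balanced_recurrent (bdry G b) bal; exists e => //.
  by apply: filterS he => k; rewrite /visits; under eq_bigr do rewrite -observe_eq.
apply: filterS (bal n (bdry G b) (bdry G c)) => k; rewrite /imbalance.
by under eq_bigr do rewrite -!observe_eq.
Qed.

(** Subtracting the two frequency estimates leaves the difference of the probabilities
times the number of visits to b, which is of order T_k, whereas the error is
o(T_k). *)
Lemma compatible_same_kernel s G G' : compatible s G -> compatible s G' -> same_kernel G G'.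
Proof.
move=> [rec freq] [_ freq'] n b c.
have [e e0 he] := rec b.
set q := LHS; set q' := RHS; apply/eqP; rewrite -subr_eq0; apply/negPn/negP => qq'.
have nqq' : 0 < `|q - q'| by rewrite normr_gt0.
near \oo%classic => k.
have fk : `|\sum_(t < sample_time k) (s t == Some b)%:R * ((s (t + n)%N == Some c)%:R - q)|
   <= (tolerance k)%:R by near: k; exact: freq.
have fk' : `|\sum_(t < sample_time k) (s t == Some b)%:R * ((s (t + n)%N == Some c)%:R - q')|
   <= (tolerance k)%:R by near: k; exact: freq'.
have ek : e * (sample_time k)%:R <= \sum_(t < sample_time k) (s t == Some b)%:R by near: k.
have kbig : 2 / (e * `|q - q'|) <= k%:R by near: k; exact: nbhs_infty_ger.
have sumE r : \sum_(t < sample_time k) (s t == Some b)%:R * ((s (t + n)%N == Some c)%:R - r)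
   = \sum_(t < sample_time k) (s t == Some b)%:R * (s (t + n)%N == Some c)%:R
     - (\sum_(t < sample_time k) (s t == Some b)%:R) * r :> R.
  by under eq_bigr do rewrite mulrBr; rewrite sumrB mulr_suml.
rewrite !sumE in fk fk'; move: fk fk' ek.
set V := \sum_(t < _) (s t == _)%:R; set W := \sum_(t < _) _ * _ => fk fk' ek.
have V0 : 0 <= V by exact: sumr_ge0.
have upper : `|q - q'| * V <= 2 * (tolerance k)%:R.
  rewrite -(ger0_norm V0) -normrM.
  have -> : (q - q') * V = (W - V * q') - (W - V * q) by ring.
  by apply: le_trans (ler_normB _ _) _; lra.
have lower := ler_wpM2l (ltW nqq') ek.
have t0 : 0 < (tolerance k)%:R :> R by rewrite ltr0n tolerance_gt0.
have pos : 0 < e * `|q - q'| by exact: mulr_gt0.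
move: kbig; rewrite ler_pdivrMr// => /(ler_wpM2r (ltW t0)) kbig.
have := mulr_gt0 pos t0; move: lower; rewrite /sample_time natrM -(natr1 k).
lra.
Unshelve. all: by end_near.
Qed.

End Compatible.

(** * Equivalence classes and the reconstruction map *)

Section Class.
Context (R : realType) (B : finType).
Implicit Types G : netwalk R B.

Lemma equivalent_sym G G' : equivalent G G' -> equivalent G' G.
Proof.
move=> [Phi [[Psi PhiK PsiK] ePhi bPhi tPhi]]; exists Psi; split.
- by exists Phi.
- by move=> x y; rewrite -ePhi !PsiK.
- by move=> b; rewrite -bPhi PhiK.
- by move=> x y; rewrite -tPhi !PsiK.
Qed.

Lemma equivalent_trans G1 G2 G3 :
  equivalent G1 G2 -> equivalent G2 G3 -> equivalent G1 G3.
Proof.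
move=> [Phi [Phi_bij ePhi bPhi tPhi]] [Psi [Psi_bij ePsi bPsi tPsi]].
exists (Psi \o Phi); split=> [|x y|b|x y] /=; first exact: bij_comp.
- by rewrite ePsi ePhi.
- by rewrite bPhi bPsi.
- by rewrite tPsi tPhi.
Qed.

Lemma netclass_of_eq G G' : equivalent G G' -> netclass_of G = netclass_of G'.
Proof.
move=> GG'; apply: eq_exist; apply/funext => K; apply/propext; split.
  by apply: equivalent_trans; exact: equivalent_sym.
exact: equivalent_trans.
Qed.

(** Without boundary vertices no point is extreme, so the Two-Points Condition leaves
room for one vertex only. *)
Lemma vert_singleton G : (forall b : B, False) -> forall x y : vert G, x = y.
Proof.
move=> noB x y; apply/eqP/negPn/negP => nxy.
have /edge_two_points[_ [_ [_ [_ [b _]] _]]] : (2 <= #|[set: vert G]%SET|)%N.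
  by apply/card_gt1P; exists x, y; rewrite !inE.
exact: noB b.
Qed.

Lemma same_kernel_equivalent G G' : same_kernel G G' -> equivalent G G'.
Proof.
move=> GG'; have [[b0]|noB] := pselect (inhabited B).
  exact (same_kernel_equivalent_nonempty b0 GG').
have nB (b : B) : False by exact/noB/inhabits.
have /card_gt0P[x0 _] := vert_nonempty G; have /card_gt0P[y0 _] := vert_nonempty G'.
have tr1 (K : netwalk R B) (x : vert K) : trans x x = 1.
  by rewrite -(trans_sum1 x) (bigD1 x)//= big1 ?addr0// => y; rewrite (vert_singleton nB y x) eqxx.
exists (fun=> y0); split.
- by exists (fun=> x0) => z; exact: vert_singleton.
- by move=> x y; rewrite (vert_singleton nB x y) !edge_irr.
- by move=> b; case: (nB b).
- by move=> x y; rewrite (vert_singleton nB x y) !tr1.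
Qed.

(** In a complete graph each vertex of the boundary is at distance 0 from itself and 1
from all others, hence extreme in every set that contains it. *)
Lemma complete_netwalk (V : finType) (bd : B -> V) :
    injective bd -> (0 < #|V|)%N ->
    (forall x y : V, x != y -> exists b, bd b = x) ->
  inhabited (netwalk R B).
Proof.
move=> bd_inj V0 bd_onto; pose e (x y : V) := x != y.
pose p (x y : V) : R := 1 / \sum_(z | e x z || (z == x)) 1.
have e_conn x y : connect e x y.
  by have [->|nxy] := eqVneq x y; [exact: connect0|exact: connect1].
have d0 x : gdist e x x = 0%N.
  by have [_ /(_ [::] isT erefl)] := gdistP (e_conn x x); rewrite leqn0 => /eqP.
have dgt0 x y : y != x -> (gdist e x x < gdist e x y)%N.
  rewrite d0 lt0n; apply: contraNN => /eqP dxy.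
  have [[q [_ lq +]] _] := gdistP (e_conn x y).
  by rewrite dxy -lq => /size0nil ->.
have tp : two_points bd e.
  move=> S /card_gt1P[x [y [xS yS nxy]]].
  have ext z w : z \in S -> z != w -> extreme bd e S z.
    by move=> zS /bd_onto[b bz]; split=> //; exists b => u _; rewrite bz; exact: dgt0.
  by exists x, y; split=> //; [exact: ext nxy|apply: (ext y x); rewrite // eq_sym].
have adm : admissible e p.
  exists (fun _ _ => 1); split=> //.
    by move=> x; rewrite (bigD1 x) ?eqxx ?orbT//= ltr_pwDl// sumr_ge0.
  by move=> x y; rewrite /e eq_sym orNb.
exact: inhabits (@NetWalk R B V bd e p bd_inj (fun x y => congr1 negb (eq_sym x y))
  (fun x => congr1 negb (eqxx x)) V0 e_conn tp adm).
Qed.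

(** A value is needed for the reconstruction map at sequences compatible with no
network. *)
Lemma netwalk_inhabited : inhabited (netwalk R B).
Proof.
have [B0|B0] := posnP #|B|.
  apply: (@complete_netwalk unit (fun=> tt)); last by case=> [[]].
    by move=> b; have := fintype0 b B0.
  by rewrite card_unit.
by apply: (@complete_netwalk B id) => // x y _; exists x.
Qed.

End Class.

Theorem theorem1p6 (R : realType) (B : finType) :
  exists Rec : (nat -> option B) -> netclass R B,
    forall (G : netwalk R B) (x0 : vert G)
      (d : measure_display) (Omega : measurableType d)
      (P : probability Omega R) (H : nat -> Omega -> vert G),
      markov_chain P (@trans R B G) x0 H ->
      with_probability_one P
        (fun w : Omega =>
           Rec (fun t : nat => observe (@bdry R B G) (H t w)) = netclass_of G).
Proof.
have [G0] := netwalk_inhabited R B.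
have rec s : exists G : netwalk R B, 
    (exists G' : netwalk R B, compatible s G') -> compatible s G.
  have [[G sG]|noG] := pselect (exists G : netwalk R B, compatible s G).
    by exists G.
  by exists G0 => /noG.
exists (fun s => netclass_of (projT1 (cid (rec s)))) => G x0 d Omega P H mc.
have [A [mA A0 nbalA]] := ae_balanced mc (@trans_ge0 _ _ G) (@trans_sum1 _ _ G).
exists (~` A); split; first exact: measurableC.
  by rewrite probability_setC// A0 sube0.
move=> w nAw; set s := (fun t => observe _ _).
have sG : compatible s G.
  apply: balanced_compatible; apply: contrapT => nbal; apply: nAw.
  exact: nbalA.
apply/netclass_of_eq/same_kernel_equivalent.
case: cid => G' /= /(_ (ex_intro _ G sG)) sG'.
exact: compatible_same_kernel sG' sG.
Qed.
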